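(* (Generalized Hall's Theorem) Let $x,r\in\mathbb N$ and consider a bipartite graph $\mathcal G$ with two sets of nodes, $\mathcal T_1$ with $x$ nodes and $\mathcal T_2$ with $x+r$ nodes. Suppose that for each nonempty subset $\mathcal S$ of $\mathcal T_1$ the inequality $|N(\mathcal S)|\ge|\mathcal S|+r$ holds. Then there exists a spanning subgraph $\mathcal G'$ of $\mathcal G$ such that every node of $\mathcal T_1$ has degree $r+1$ in $\mathcal G'$, and for each nonempty subset $\mathcal S$ of $\mathcal T_1$ the inequality $|N(\mathcal S)|\ge|\mathcal S|+r$ also holds with neighborhoods taken in $\mathcal G'$.
   Context: For a set of nodes $\mathcal S$, $N(\mathcal S)$ denotes the set of all nodes adjacent to at least one node of $\mathcal S$. A spanning subgraph has the same node set and a subset of the edges. *)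

(* Defs.v *)
From mathcomp Require Import all_boot.

Set Implicit Arguments.
Unset Strict Implicit.
Unset Printing Implicit Defensive.

Record sgraph (V : finType) := SGraph {
  adj :> rel V;
  adj_sym : symmetric adj;
  adj_irrefl : irreflexive adj }.

Section Graphs.
Variable V : finType.
Implicit Types (G H : sgraph V) (S A B : {set V}) (v : V).

Definition nbhd G S : {set V} := [set v | [exists u in S, adj G u v]].

Definition degree G v : nat := #|[set u | adj G v u]|.

(* Graphs on the same type V share their node set, so only the edges are
   compared. *)
Definition spanning_subgraph H G : Prop := subrel (adj H) (adj G).

(* A side may be empty, and G may have isolated nodes on either side. *)
Definition bipartition G A B : Prop :=
  [/\ A :|: B = [set: V],
      [disjoint A & B] &
      forall u v, adj G u v ->
        (u \in A) && (v \in B) || (u \in B) && (v \in A)].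

End Graphs.

(* Main.v *)
Require Import Defs.
From mathcomp Require Import all_boot.
From mathcomp Require Import zify.

Set Implicit Arguments.
Unset Strict Implicit.
Unset Printing Implicit Defensive.

(** View the graph as the family of neighbourhoods [F i] of the nodes [i] of
    the first side, and delete edges one at a time as long as the Hall condition
    with surplus [r] survives. The claim is that some edge at [v] can be deleted
    as soon as [v] has more than [r.+1] neighbours ([hall_delete_edge]); since
    the condition for [[set v]] forces at least [r.+1] neighbours, a family from
    which no further edge can be deleted has all degrees equal to [r.+1].

    For the claim, suppose that no edge at [v] can be deleted. Then each
    neighbour [w] of [v] has a witness ([blocked_edge_tight]): a set [S] through
    [v] that meets the condition with equality (a tight set) and in which [v] is
    the only node adjacent to [w]. The function sending [S] to the size of its
    neighbourhood is submodular, so two tight sets that meet have a tight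
    intersection ([tight_setI]). Hence a smallest tight set [S] through [v] lies
    in all the witnesses, and no neighbour of [v] is adjacent to another node
    of [S]. The neighbourhood of [S] is then the disjoint union of those of [v]
    and of [S :\ v], and the first alone has more than [r.+1] elements, which is
    too many for [S] to be tight. *)

Section HallSurplus.

Variables (I W : finType) (r : nat) (A : {set I}).
Implicit Types (F : I -> {set W}) (S T : {set I}).

Definition family_nbhd F S : {set W} := \bigcup_(i in S) F i.

Definition hall F : bool :=
  [forall S : {set I}, (S \subset A) && (S != set0) ==>
    (#|S| + r <= #|family_nbhd F S|)].

Definition tight F S : bool := #|family_nbhd F S| == #|S| + r.

Definition delete_edge F v w : I -> {set W} :=
  fun i => if i == v then F i :\ w else F i.

Lemma hallP F :
  reflect (forall S, S \subset A -> S != set0 ->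
             #|S| + r <= #|family_nbhd F S|)
          (hall F).
Proof.
apply: (iffP forallP) => [h S sSA S0 | h S].
  by have := h S; rewrite sSA S0.
by apply/implyP => /andP[]; apply: h.
Qed.

(** Submodularity: [#|N(S :|: T)| + #|N(S :&: T)| <= #|N(S)| + #|N(T)|]. The
    right-hand side is as small as the Hall condition allows, so both terms on
    the left are too. *)
Lemma tight_setI F S T :
    hall F -> S \subset A -> T \subset A -> S :&: T != set0 ->
  tight F S -> tight F T -> tight F (S :&: T).
Proof.
move=> /hallP hF sSA sTA ST0 /eqP tS /eqP tT.
have U0 : S :|: T != set0.
  by apply: contraNneq ST0 => U0; rewrite -subset0 -U0 subIset // subsetUl.
have sIA : S :&: T \subset A by rewrite subIset // sSA.
have sUA : S :|: T \subset A by rewrite subUset sSA.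
have nU : family_nbhd F (S :|: T) = family_nbhd F S :|: family_nbhd F T.
  exact: bigcup_setU.
have nI : family_nbhd F (S :&: T) \subset family_nbhd F S :&: family_nbhd F T.
  apply/bigcupsP => i; rewrite inE => /andP[iS iT].
  by rewrite subsetI (bigcup_sup i iS) // (bigcup_sup i iT).
have := hF _ sIA ST0; have := hF _ sUA U0; rewrite nU.
have := subset_leq_card nI.
have := cardsUI (family_nbhd F S) (family_nbhd F T).
have := cardsUI S T.
rewrite /tight; lia.
Qed.

(** A set that violates the condition after the deletion has lost a neighbour,
    and only one; so it was tight, and [w] was attached to it through [v]
    alone. *)
Lemma blocked_edge_tight F v w :
    hall F -> ~~ hall (delete_edge F v w) ->
  exists S, [/\ S \subset A, v \in S, tight F S & w \notin family_nbhd F (S :\ v)].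
Proof.
move=> /hallP hF /forallPn[S]; rewrite negb_imply -ltnNge.
move=> /andP[/andP[sSA S0]]; set F' := delete_edge F v w => viol.
have keep i x : x \in F i -> (i != v) || (x != w) -> x \in F' i.
  by rewrite /F' /delete_edge; case: eqP => //= _ xFi xw; rewrite !inE xw.
have hS := hF S sSA S0.
have sub1 : family_nbhd F S :\ w \subset family_nbhd F' S.
  apply/subsetP => x; rewrite !inE => /andP[xw /bigcupP[i iS xFi]].
  by apply/bigcupP; exists i => //; apply: keep => //; rewrite xw orbT.
have wN : w \in family_nbhd F S :\: family_nbhd F' S.
  have /subsetPn[x xN xN'] : ~~ (family_nbhd F S \subset family_nbhd F' S).
    by apply/negP => /subset_leq_card; lia.
  suff -> : w = x by rewrite inE xN xN'.
  apply/esym/eqP; apply: contraNT xN' => xw.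
  by apply: (subsetP sub1); rewrite !inE xw.
move: wN; rewrite inE => /andP[wN' wN].
exists S; split => //.
- case/bigcupP: wN => i iS wFi.
  suff <- : i = v by [].
  apply/eqP; apply: contraNT wN' => iv.
  by apply/bigcupP; exists i => //; apply: keep => //; rewrite iv.
- have := subset_leq_card sub1; have := cardsD1 w (family_nbhd F S).
  by rewrite wN /tight; lia.
- apply: contra wN' => /bigcupP[i]; rewrite !inE => /andP[iv iS] wFi.
  by apply/bigcupP; exists i => //; apply: keep => //; rewrite iv.
Qed.

(** Among the tight sets through [v] there is one contained in all the
    obstructions to deleting an edge at [v]. In it the neighbours of [v] are
    private to [v], which leaves it with too large a neighbourhood. *)
Lemma hall_delete_edge F v :
    hall F -> v \in A -> r.+1 < #|F v| ->
  exists2 w, w \in F v & hall (delete_edge F v w).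
Proof.
move=> hF vA degv.
have [/exists_inP //|/exists_inPn blocked] :=
  boolP [exists w in F v, hall (delete_edge F v w)].
pose P S := [&& S \subset A, v \in S & tight F S].
have [w0 w0v] : exists w, w \in F v by apply/set0Pn; rewrite -card_gt0; lia.
have [S0 [S0A vS0 tS0 _]] := blocked_edge_tight hF (blocked _ w0v).
have PS0 : P S0 by apply/and3P.
case: (arg_minnP (fun S : {set I} => #|S|) PS0) => S /and3P[SA vS tS] minS.
have private w : w \in F v -> w \notin family_nbhd F (S :\ v).
  move=> wv; have [T [TA vT tT wT]] := blocked_edge_tight hF (blocked _ wv).
  have vST : v \in S :&: T by rewrite inE vS.
  have PST : P (S :&: T).
    rewrite /P vST subIset ?SA //= tight_setI //.
    by apply/set0Pn; exists v.
  have /eqP eST : S :&: T == S by rewrite eqEcard subsetIl minS.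
  apply: contra wT => /bigcupP[i]; rewrite !inE => /andP[iv iS] wFi.
  apply/bigcupP; exists i => //; rewrite !inE iv /=.
  by move: iS; rewrite -eST inE => /andP[].
have nS : family_nbhd F S = F v :|: family_nbhd F (S :\ v).
  by rewrite /family_nbhd (big_setD1 v vS).
have disj : [disjoint F v & family_nbhd F (S :\ v)].
  by rewrite disjoint_subset; apply/subsetP => w /private.
move: tS; rewrite /tight nS cardsU (disjoint_setI0 disj) cards0 subn0.
rewrite (cardsD1 v S) vS.
(* If [S :\ v] is nonempty, its own surplus gives [S] more than
   [(r + 1) + (#|S| - 1 + r)] neighbours, hence more than [#|S| + r]. *)
have [-> | Sv0] := eqVneq (S :\ v) set0.
  by rewrite cards0; lia.
have SvA : S :\ v \subset A by apply: subset_trans SA; apply: subsetDl.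
by have := hallP _ hF _ SvA Sv0; lia.
Qed.

Lemma hall_card_ge F v : hall F -> v \in A -> r.+1 <= #|F v|.
Proof.
move=> /hallP hF vA; have := hF [set v].
rewrite sub1set cards1 /family_nbhd big_set1 add1n; apply=> //.
by apply/set0Pn; exists v; rewrite set11.
Qed.

Lemma hall_regular_subfamily F :
    hall F ->
  exists F', [/\ forall i, F' i \subset F i, hall F' &
                 forall i, i \in A -> #|F' i| = r.+1].
Proof.
have [n] := ubnP (\sum_i #|F i|); elim: n F => // n IHn F leFn hF.
have [/exists_inP[v vA degv] | /exists_inPn small] :=
  boolP [exists v in A, r.+1 < #|F v|]; last first.
  exists F; split=> // i iA; apply/eqP.
  by rewrite eqn_leq hall_card_ge // andbT leqNgt small.
have [w wv hF'] := hall_delete_edge hF vA degv.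
have sub i : delete_edge F v w i \subset F i.
  by rewrite /delete_edge; case: eqP => // _; apply: subsetDl.
have [|F'' [sF'' hF'' dF'']] := IHn _ _ hF'.
  rewrite -ltnS; apply: leq_trans leFn; rewrite ltnS (bigD1 v) //= [X in _ < X](bigD1 v) //=.
  rewrite -addSn leq_add //.
    by rewrite /delete_edge eqxx [X in _ < X](cardsD1 w) wv.
  by apply: leq_sum => i _; apply: subset_leq_card.
by exists F''; split=> // i; apply: subset_trans (sub i).
Qed.

End HallSurplus.

Section FamilyGraph.

Variables (V : finType) (A : {set V}) (F : V -> {set V}).

(** Only the sets attached to nodes of [A] produce edges; avoiding [A], they
    produce neither loops nor edges inside [A]. *)
Hypothesis F_avoids : forall u, u \in A -> [disjoint F u & A].

Definition family_rel : rel V :=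
  fun u v => (u \in A) && (v \in F u) || (v \in A) && (u \in F v).

Lemma family_rel_sym : symmetric family_rel.
Proof. by move=> u v; rewrite /family_rel orbC. Qed.

Lemma family_rel_in u v : u \in A -> family_rel u v = (v \in F u).
Proof.
move=> uA; rewrite /family_rel uA /=; have [vA | _] := boolP (v \in A).
  by rewrite (disjointFl (F_avoids vA) uA) orbF.
by rewrite orbF.
Qed.

Lemma family_rel_irrefl : irreflexive family_rel.
Proof.
move=> u; have [uA | uNA] := boolP (u \in A).
  by rewrite family_rel_in // (disjointFl (F_avoids uA) uA).
by rewrite /family_rel (negPf uNA).
Qed.

Definition family_graph : sgraph V :=
  SGraph family_rel_sym family_rel_irrefl.

End FamilyGraph.

Lemma nbhd_bigcup (V : finType) (G : sgraph V) (F : V -> {set V})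
    (S : {set V}) :
  (forall u v, u \in S -> adj G u v = (v \in F u)) ->
  nbhd G S = family_nbhd F S.
Proof.
move=> adjF; apply/setP => v; rewrite inE.
apply/exists_inP/bigcupP => -[u uS uv]; exists u => //.
  by rewrite -adjF.
by rewrite adjF.
Qed.

Theorem theorem6 (x r : nat) (V : finType) (G : sgraph V) (T1 T2 : {set V})
    (hbip : bipartition G T1 T2)
    (hT1 : #|T1| = x) (hT2 : #|T2| = x + r)
    (hN : forall S : {set V}, S \subset T1 -> S != set0 ->
            #|S| + r <= #|nbhd G S|) :
  exists G' : sgraph V,
    [/\ spanning_subgraph G' G,
        forall v, v \in T1 -> degree G' v = r.+1 &
        forall S : {set V}, S \subset T1 -> S != set0 ->
          #|S| + r <= #|nbhd G' S|].
Proof.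
have [_ T12 edges] := hbip.
pose F v := [set u | adj G v u].
have hF : hall r T1 F.
  apply/hallP => S ST S0; rewrite -(@nbhd_bigcup _ G) ?hN // => u v _.
  by rewrite inE.
have [F' [sF' hF' dF']] := hall_regular_subfamily hF.
have F'_avoids u : u \in T1 -> [disjoint F' u & T1].
  move=> uT; rewrite disjoint_subset; apply/subsetP => v /(subsetP (sF' u)); rewrite inE.
  move=> /edges; rewrite (disjointFr T12 uT) /= orbF => /andP[_ vT2].
  by rewrite inE (disjointFl T12 vT2).
exists (family_graph F'_avoids); split.
- move=> u v /= /orP[] /andP[_ /(subsetP (sF' _))]; rewrite inE //.
  by rewrite adj_sym.
- move=> v vT; rewrite -(dF' v vT) /degree; apply: eq_card => u.
  by rewrite inE /= family_rel_in.
- move=> S ST S0; rewrite (@nbhd_bigcup _ _ F').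
    exact: (hallP _ _ _ hF').
  by move=> u v /(subsetP ST) uT; rewrite /= family_rel_in.
Qed.
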